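(* For every $N\geqslant 2$ there exists a piecewise affine contracting interval map $f$ (affine on each contraction piece) which has $N$ contraction pieces and satisfies the separation property, whose attractor $\Lambda$ is a minimal Cantor set, and such that every discontinuity of $f$ is left-right recurrently visited by every orbit, i.e. $\Delta_{lr}(x)=\Delta$ for all $x\in X$.
   Context: Let $X$ be a compact interval of $\mathbb{R}$ and $X_1<\dots<X_N$ ($N\geqslant 2$) non-empty pairwise disjoint intervals, open in $X$, with $X=\bigcup_i\overline{X_i}$; $\Delta:=\{x\in\overline{X_i}\cap\overline{X_j}:i\neq j\}=\{c_1,\dots,c_{N-1}\}$, $\{c_i\}=\overline{X_i}\cap\overline{X_{i+1}}$. A piecewise contracting interval map is $f:X\to X$, discontinuous at every point of $\Delta$, with some $\lambda\in(0,1)$ such that $|f(x)-f(y)|\leqslant\lambda|x-y|$ for $x,y$ in the same $X_i$; $f_i$ denotes the continuous extension of $f|_{X_i}$ to $\overline{X_i}$. Separation property: each $f_i$ injective and $f_i(\overline{X_i})\cap f_j(\overline{X_j})=\emptyset$ for $i\neq j$. Atoms: $F_i(A):=\overline{f(A\cap X_i)}$, $A_{i_1\dots i_n}:=F_{i_n}\circ\dots\circ F_{i_1}(X)$ is an atom of generation $n$ if non-empty; $\mathcal{A}_n$ is the set of atoms of generation $n$; $\mathcal{A}_n(x):=\{A\in\mathcal{A}_n:\exists t\in\mathbb{N},\ f^{t+n}(x)\in A\}$. The attractor is $\Lambda:=\bigcap_{n\geqslant1}\bigcup_{A\in\mathcal{A}_n}A$. $c_i$ is $n$-left-right visited by the orbit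 of $x$ if there is $A\in\mathcal{A}_n(x)$ with $c_i\in A$, $f^{t+n}(x)\in A\cap X_i$ and $f^{t'+n}(x)\in A\cap X_{i+1}$ for some $t,t'\in\mathbb{N}$; $\Delta^n_{lr}(x)$ is the set of such discontinuities and $\Delta_{lr}(x):=\bigcap_{n\geqslant 1}\Delta^n_{lr}(x)$. $\Lambda$ minimal means $f(\Lambda)\subset\Lambda$ and the forward orbit of every point of $\Lambda$ is dense in $\Lambda$. *)

(* Defs.v *)
From HB Require Import structures.
From mathcomp Require Import all_boot all_order all_algebra.
From mathcomp Require Import all_classical all_reals all_analysis.
Set Implicit Arguments. Unset Strict Implicit. Unset Printing Implicit Defensive.
Import Order.TTheory GRing.Theory Num.Theory.
Import numFieldNormedType.Exports.
Local Open Scope classical_set_scope.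
Local Open Scope ring_scope.

Section PCM.
Variable R : realType.

(* Pieces are indexed 0..N-1 (paper: X_1 < ... < X_N). *)

Definition interval_partition (a b : R) (N : nat) (P : nat -> set R) :=
  [/\ (forall i, (i < N)%N -> P i !=set0 /\ is_interval (P i)),
      (forall i, (i < N)%N -> exists U : set R, open U /\ P i = U `&` `[a, b]%classic),
      (forall i j, (i < N)%N -> (j < N)%N -> i <> j -> P i `&` P j = set0),
      (forall i j x y, (i < j)%N -> (j < N)%N -> P i x -> P j y -> x < y) &
      \bigcup_(i in [set i | (i < N)%N]) closure (P i) = `[a, b]%classic ].

Definition Delta (N : nat) (P : nat -> set R) : set R :=
  [set c | exists i j, [/\ (i < N)%N, (j < N)%N, i <> j,
                           closure (P i) c & closure (P j) c]].

Definition piecewise_contracting (a b : R) (N : nat) (P : nat -> set R)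
    (f : R -> R) :=
  [/\ interval_partition a b N P,
      f @` `[a, b]%classic `<=` `[a, b]%classic,
      (forall c, Delta N P c -> ~ (f @ within `[a, b]%classic (nbhs c) --> f c)) &
      exists lam : R, [/\ 0 < lam, lam < 1 &
        forall i x y, (i < N)%N -> P i x -> P i y ->
          `|f x - f y| <= lam * `|x - y| ] ].

Definition piecewise_affine (N : nat) (P : nat -> set R) (f : R -> R) :=
  forall i, (i < N)%N -> exists alpha beta : R,
    forall x, P i x -> f x = alpha * x + beta.

Definition is_piece_extension (P : nat -> set R) (f : R -> R) (i : nat)
    (g : R -> R) :=
  {within closure (P i), continuous g} /\ (forall x, P i x -> g x = f x).

Definition separation (N : nat) (P : nat -> set R) (f : R -> R) :=
  exists g : nat -> R -> R,
    [/\ (forall i, (i < N)%N -> is_piece_extension P f i (g i)),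
        (forall i, (i < N)%N -> set_inj (closure (P i)) (g i)) &
        (forall i j, (i < N)%N -> (j < N)%N -> i <> j ->
           g i @` closure (P i) `&` g j @` closure (P j) = set0)].

Definition Fop (P : nat -> set R) (f : R -> R) (i : nat) (A : set R) :=
  closure (f @` (A `&` P i)).

Definition atom (a b : R) (P : nat -> set R) (f : R -> R) (w : seq nat) :=
  foldl (fun A i => Fop P f i A) `[a, b]%classic w.

Definition word (N n : nat) (w : seq nat) := size w = n /\ all (fun i => (i < N)%N) w.

Definition atoms (a b : R) (N : nat) (P : nat -> set R) (f : R -> R) (n : nat)
  : set (set R) :=
  [set A | exists w, [/\ word N n w, A = atom a b P f w & A !=set0]].

Definition attractor (a b : R) (N : nat) (P : nat -> set R) (f : R -> R) : set R :=
  \bigcap_(n in [set n | (1 <= n)%N])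
    \bigcup_(A in atoms a b N P f n) A.

Definition atoms_of (a b : R) (N : nat) (P : nat -> set R) (f : R -> R)
    (n : nat) (x : R) : set (set R) :=
  [set A | atoms a b N P f n A /\ exists t : nat, A (iter (t + n) f x)].

(* Delta^n_lr(x); the discontinuity c_{i+1} (paper numbering) is the point
   of closure (P i) cap closure (P i.+1). *)
Definition Delta_lr_n (a b : R) (N : nat) (P : nat -> set R) (f : R -> R)
    (n : nat) (x : R) : set R :=
  [set c | exists i, [/\ (i.+1 < N)%N, closure (P i) c, closure (P i.+1) c &
     exists A, [/\ atoms_of a b N P f n x A, A c,
        (exists t : nat, A (iter (t + n) f x) /\ P i (iter (t + n) f x)) &
        (exists t' : nat, A (iter (t' + n) f x) /\ P i.+1 (iter (t' + n) f x))]]].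

Definition Delta_lr (a b : R) (N : nat) (P : nat -> set R) (f : R -> R)
    (x : R) : set R :=
  \bigcap_(n in [set n | (1 <= n)%N]) Delta_lr_n a b N P f n x.

Definition minimal_set (f : R -> R) (L : set R) :=
  f @` L `<=` L /\
  forall x, L x -> L `<=` closure [set iter t f x | t in [set: nat]].

Definition cantor_set (K : set R) :=
  [/\ K !=set0, compact K, perfect_set K & totally_disconnected K].

End PCM.

(* Main.v *)
Require Import Defs.
From HB Require Import structures.
From mathcomp Require Import all_boot all_order all_algebra.
From mathcomp Require Import all_classical all_reals all_analysis.
From mathcomp Require Import ring lra zify.
Set Implicit Arguments. Unset Strict Implicit. Unset Printing Implicit Defensive.
Import Order.TTheory GRing.Theory Num.Theory.
Import numFieldNormedType.Exports.
Local Open Scope classical_set_scope.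
Local Open Scope ring_scope.

(* The map is a Denjoy-type blow-up of the rotation [turn] of the circle by
   [sqrt 2 - 1]. Choose M = N - 1 points [brk i] of the circle, one of them the
   point where the rotation wraps around, with orbits that are pairwise disjoint,
   and open at the n-th image (n >= 1) of each of them a gap of length 2^-(n-1).
   With [phim t] and [phip t] the total length of the gaps before [t], without and
   with the gap at [t], every point of X = [1, 2M] lies in [[phim t, phip t]] for
   some angle [t]. The rotation lifts to a map of slope 1/2 which creates a gap of
   length 1 exactly at the M points [cut i] lying over the [brk i]; these are its
   discontinuities, and the new gaps separate the images of the pieces.

   The attractor is what remains of X when the open gaps are removed. Every orbit
   projects to an orbit of the rotation, hence is dense in it and comes close to
   each [cut i] from both sides. As no backward orbit of a [brk i] meets another
   [brk j], the itineraries of length n are constant near the n-th preimage of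
   [brk i], so a single atom of generation n contains [cut i] and the visits on
   its two sides. *)

(** * Series with ratio one half *)

Section HalfSeries.
Variable R : realType.
Implicit Types (u v : nat -> R) (C : R).

Definition half_series u : R := limn (series (fun n => 2^-1 ^+ n * u n)).

Definition bounded_by C u := forall n, `|u n| <= C.

Lemma half_series_cvg C u : bounded_by C u ->
  cvgn (series (fun n => 2^-1 ^+ n * u n)).
Proof.
move=> uC; apply: normed_cvg.
apply: (@series_le_cvg _ _ (geometric C 2^-1)).
- by move=> n; exact: normr_ge0.
- move=> n /=; apply: mulr_ge0; last by rewrite exprn_ge0 ?invr_ge0.
  exact: le_trans (normr_ge0 _) (uC 0%N).
- move=> n /=; rewrite normrM ger0_norm ?exprn_ge0 ?invr_ge0// mulrC.
  by rewrite ler_wpM2r ?exprn_ge0 ?invr_ge0.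
- apply: is_cvg_geometric_series; rewrite ger0_norm ?invr_ge0//; lra.
Qed.

Lemma half_seriesD C D u v : bounded_by C u -> bounded_by D v ->
  half_series (fun n => u n + v n) = half_series u + half_series v.
Proof.
move=> uC vD; rewrite /half_series.
rewrite -lim_seriesD; [|exact: half_series_cvg uC|exact: half_series_cvg vD].
by congr (limn (series _)); apply/funext => n /=; rewrite mulrDr.
Qed.

Lemma half_seriesN C u : bounded_by C u ->
  half_series (fun n => - u n) = - half_series u.
Proof.
move=> uC; rewrite /half_series -lim_seriesN; last exact: half_series_cvg uC.
by congr (limn (series _)); apply/funext => n /=; rewrite mulrN.
Qed.

Lemma half_series_cst C : half_series (fun=> C) = 2 * C.
Proof.
rewrite /half_series.
have h : `|2^-1 : R| < 1 by rewrite ger0_norm ?invr_ge0//; lra.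
rewrite (_ : series _ = series (geometric C 2^-1)); last first.
  by congr series; apply/funext => n /=; rewrite mulrC.
apply: cvg_lim => //.
rewrite (_ : 2 * C = C * (1 - 2^-1)^-1); first exact: cvg_geometric_series.
by field.
Qed.

Lemma le_half_series C D u v : bounded_by C u -> bounded_by D v ->
  (forall n, u n <= v n) -> half_series u <= half_series v.
Proof.
move=> uC vD uv; apply: lim_series_le.
- exact: half_series_cvg uC.
- exact: half_series_cvg vD.
- by move=> n; rewrite ler_wpM2l ?exprn_ge0 ?invr_ge0.
Qed.

(** Dropping the first term halves the remaining weights; this is where the slope 1/2 of the lifted
    map comes from. *)
Lemma half_series_recl C u : bounded_by C u ->
  half_series u = u 0%N + 2^-1 * half_series (fun n => u n.+1).
Proof.
move=> uC; have uC' : bounded_by C (fun n => u n.+1) by move=> n; exact: uC.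
have cu := half_series_cvg uC; have cu' := half_series_cvg uC'.
rewrite {1}/half_series; apply: cvg_lim => //.
rewrite -(cvg_shiftS (series (fun n => 2^-1 ^+ n * u n))).
rewrite (_ : (fun n => _) = fun n : nat =>
  u 0%N + 2^-1 * series (fun n => 2^-1 ^+ n * u n.+1) n).
  by apply: cvgD; [exact: cvg_cst|apply: cvgM; [exact: cvg_cst|exact: cu']].
apply/funext => n; rewrite /series /= big_nat_recl// expr0 mul1r; congr (_ + _).
by rewrite big_distrr /=; apply: eq_bigr => i _; rewrite exprS mulrA.
Qed.

Lemma half_series_bound C u : bounded_by C u -> `|half_series u| <= 2 * C.
Proof.
move=> uC; have C0 : 0 <= C by exact: le_trans (normr_ge0 _) (uC 0%N).
have bC : bounded_by C (fun=> C) by move=> n; rewrite ger0_norm.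
have bNC : bounded_by C (fun=> - C) by move=> n; rewrite normrN ger0_norm.
rewrite ler_norml; apply/andP; split.
  rewrite -mulrN -half_series_cst; apply: (le_half_series bNC uC) => n.
  by have := uC n; rewrite ler_norml => /andP[].
rewrite -half_series_cst; apply: (le_half_series uC bC) => n.
by have := uC n; rewrite ler_norml => /andP[].
Qed.

(** Each common first term splits off by the recursion and leaves a factor 1/2; after [m] steps the
    two remaining sums are at most [2 * C] each. *)
Lemma half_series_tail C u v m : bounded_by C u -> bounded_by C v ->
  (forall n, (n < m)%N -> u n = v n) ->
  `|half_series u - half_series v| <= 2^-1 ^+ m * (4 * C).
Proof.
elim: m u v => [|m IH] u v uC vC uv.
  rewrite expr0 mul1r (le_trans (ler_normB _ _))//.
  have := half_series_bound uC; have := half_series_bound vC; lra.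
rewrite (half_series_recl uC) (half_series_recl vC) (uv 0%N)//.
rewrite (_ : _ - _ = 2^-1 * (half_series (fun n => u n.+1)
  - half_series (fun n => v n.+1))); last by ring.
rewrite normrM ger0_norm ?invr_ge0// exprS -mulrA ler_wpM2l ?invr_ge0//.
by apply: IH => [n|n|n nm]; [exact: uC|exact: vC|exact: uv].
Qed.

Lemma lt_half_series C D u v m : bounded_by C u -> bounded_by D v ->
  (forall n, u n <= v n) -> u m < v m -> half_series u < half_series v.
Proof.
elim: m u v => [|m IH] u v uC vC uv uvm.
  rewrite (half_series_recl uC) (half_series_recl vC) ltr_leD//.
  rewrite ler_wpM2l ?invr_ge0//.
  by apply: (@le_half_series C D) => n; [exact: uC|exact: vC|exact: uv].
rewrite (half_series_recl uC) (half_series_recl vC) ler_ltD//.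
rewrite ltr_pM2l ?invr_gt0//.
by apply: IH => // n.
Qed.

End HalfSeries.

(** * An irrational rotation *)

Section Rotation.
Variable R : realType.

Definition angle : R := Num.sqrt 2 - 1.

Lemma angle_sqr : angle ^+ 2 = 1 - 2 * angle.
Proof. by rewrite /angle sqrrB sqr_sqrtr// expr1n; ring. Qed.

Lemma angle_gt : 3^-1 < angle.
Proof.
rewrite /angle ltrBrDr -[ltLHS]ger0_norm; last by lra.
by rewrite -sqrtr_sqr ltr_sqrt//; nra.
Qed.

Lemma angle_lt : angle < 2^-1.
Proof.
rewrite /angle ltrBlDr -[ltRHS]ger0_norm; last by lra.
by rewrite -sqrtr_sqr ltr_sqrt//; nra.
Qed.

(* The odd powers of the angle are arbitrarily small rotations by positive
   multiples of it; both density and irrationality follow from this. *)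
Lemma angle_exp_lattice k : exists p q : nat,
  angle ^+ k.*2.+1 = q.+1%:R * angle - p%:R.
Proof.
elim: k => [|k [p [q IH]]]; first by exists 0%N, 0%N; rewrite expr1; ring.
(* As [angle ^+ 3 = 5 * angle - 2], multiplying [Q * angle - p] by [angle ^+ 2] gives
   [(5 * Q + 2 * p) * angle - (2 * Q + p)], with [Q] for [q.+1]. *)
exists (2 * q.+1 + p)%N, (5 * q.+1 + 2 * p).-1.
rewrite prednK; last by lia.
rewrite doubleS 2!exprS IH mulrA -expr2 angle_sqr.
rewrite (_ : _ * _ = q.+1%:R * angle - p%:R - 2 * (q.+1%:R * angle ^+ 2)
  + 2 * p%:R * angle); last by ring.
by rewrite angle_sqr !natrD !natrM; ring.
Qed.

Lemma angle_lattice_small (e : R) : 0 < e ->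
  exists p q : nat, 0 < q.+1%:R * angle - p%:R < e.
Proof.
move=> e0; have a3 := angle_gt; have a2 := angle_lt.
have a0 : 0 < angle by lra.
have [k _ kP] : \forall k \near \oo, `|geometric 1 angle k| < e.
  have a1 : `|angle| < 1 by rewrite ger0_norm; lra.
  exact: (cvgr0_norm_lt _ (cvg_geometric 1 a1)).
have [p [q E]] := angle_exp_lattice k; exists p, q; rewrite -E exprn_gt0//=.
have /= := kP k.*2.+1 (leq_trans (leq_addr k k) _).
rewrite mul1r ger0_norm ?exprn_ge0 ?ltW//; apply.
by rewrite addnn.
Qed.

(** Otherwise [k.+1] times a lattice element smaller than [1 / k.+1] would be an integer strictly
    between 0 and 1. *)
Lemma angle_irrational (k : nat) (z : int) : k.+1%:R * angle <> z%:~R.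
Proof.
move=> E; have [|p [q /andP[l u]]] := @angle_lattice_small k.+1%:R^-1.
  by rewrite invr_gt0.
have k0 : 0 < k.+1%:R :> R by [].
pose y : int := q.+1%:Z * z - p%:Z * k.+1%:Z.
have yE : y%:~R = k.+1%:R * (q.+1%:R * angle - p%:R).
  by rewrite /y rmorphB !rmorphM /= -E -!pmulrn; ring.
have : 0 < y%:~R :> R by rewrite yE mulr_gt0.
have : y%:~R < 1 :> R by rewrite yE mulrC -ltr_pdivlMr// mul1r.
rewrite ltr0z -[1]/(1%:~R) ltr_int; lia.
Qed.

(* Used on the closed interval [0, 1]: the end point 1 lies under the right end
   of X, and [turn 1 = turn 0]. *)
Definition turn (t : R) : R := if t < 1 - angle then t + angle else t - (1 - angle).

Lemma turn_range t : 0 <= t <= 1 -> 0 <= turn t < 1.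
Proof.
by have := angle_gt; have := angle_lt; rewrite /turn; case: ifPn => ?; lra.
Qed.

Lemma iter_turn_range n t : 0 <= t < 1 -> 0 <= iter n turn t < 1.
Proof.
by elim: n => //= n IH /IH h; apply: turn_range; lra.
Qed.

Lemma turn_inj s t : 0 <= s < 1 -> 0 <= t < 1 -> turn s = turn t -> s = t.
Proof.
by rewrite /turn; case: ifPn => ?; case: ifPn => ? ? ?; lra.
Qed.

Lemma turn_surj t : 0 <= t < 1 -> exists2 s, 0 <= s < 1 & turn s = t.
Proof.
have a3 := angle_gt; have a2 := angle_lt.
move=> t01; have [at_|ta] := leP angle t.
  by exists (t - angle); [lra|rewrite /turn ifT; lra].
by exists (t + (1 - angle)); [lra|rewrite /turn ifF; lra].
Qed.

Lemma iter_turn_surj n t : 0 <= t < 1 -> exists2 s, 0 <= s < 1 & iter n turn s = t.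
Proof.
elim: n t => [|n IH] t t01; first by exists t.
have [s s01 <-] := turn_surj t01; have [r r01 <-] := IH _ s01.
by exists r.
Qed.

Lemma iter_turn_mod n t : exists p : nat, iter n turn t = t + n%:R * angle - p%:R.
Proof.
elim: n => [|n [p IH]]; first by exists 0%N => /=; ring.
rewrite iterS; set s := iter n turn t in IH *; rewrite {1}/turn; case: ifPn => _.
  by exists p; rewrite IH -natr1; ring.
by exists p.+1; rewrite IH -!natr1; ring.
Qed.

(** Every [q.+1] turns move the angle by some [b < v - u] modulo 1, too little to jump over the
    interval. *)
Lemma turn_dense (t u v : R) : 0 <= t <= 1 -> 0 <= u -> u < v -> v <= 1 ->
  exists n, u < iter n turn t < v.
Proof.
move=> t01 u0 uv v1.
have [|p [q /andP[b0 bv]]] := @angle_lattice_small (v - u); first by lra.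
set b := _ - _ in b0 bv.
(* Aiming at [u + 1] instead of [u] keeps [x] nonnegative for every [t]; the multiple [k.+1] of [b]
   is the first to pass the target. *)
pose x := (u + 1 - t) / b.
have x0 : 0 <= x by apply: divr_ge0; lra.
have := truncn_itv x0; set k := Num.truncn x => /andP[xl xu].
have bn0 : b != 0 by rewrite gt_eqF.
have xb : x * b = u + 1 - t by rewrite /x divfK.
have xlb : k%:R * b <= u + 1 - t by rewrite -xb ler_pM2r.
have xub : u + 1 - t < k.+1%:R * b by rewrite -xb ltr_pM2r.
exists (k.+1 * q.+1)%N.
have [r rE] := iter_turn_mod (k.+1 * q.+1) t.
(* At least one turn is made, so the starting angle 1 also ends below 1. *)
have /andP[s0 s1] : 0 <= iter (k.+1 * q.+1) turn t < 1.
  by rewrite mulSn addSn iterSr; apply: iter_turn_range; exact: turn_range.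
set s := iter _ turn t in rE s0 s1 *.
(* Both [s] and [t + k.+1 * b - 1] lie in [[0, 1)] and they differ by the integer [z], which is
   therefore 0. *)
pose z : int := k.+1%:Z * p%:Z + 1 - r%:Z.
have sE : s = t + k.+1%:R * b - 1 + z%:~R.
  rewrite rE /b /z rmorphB rmorphD rmorphM /= -!pmulrn natrM; ring.
rewrite -natr1 mulrDl mul1r in xub sE.
clearbody z s b; clear rE.
have z1 : z%:~R < 1 :> R by lra.
have z2 : -1 < z%:~R :> R by lra.
have z0 : z = 0.
  have z3 : 0 < (z + 1)%:~R :> R by rewrite rmorphD /=; lra.
  by move: z1 z3; rewrite ltrz1 ltr0z; clear; lia.
rewrite z0 addr0 in sE; lra.
Qed.

Lemma turn_dense_pos (t u v : R) : 0 <= t <= 1 -> 0 <= u -> u < v -> v <= 1 ->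
  exists n, u < iter n.+1 turn t < v.
Proof.
move=> t01 u0 uv v1.
have [|n nP] := @turn_dense (turn t) u v _ u0 uv v1.
  by have := turn_range t01; lra.
by exists n; rewrite iterSr.
Qed.

End Rotation.

(** * Opening gaps along the orbits of the break points *)

Lemma seq_right_gap (R : realType) (s : seq R) (t u : R) : t < u ->
  exists t', t < t' <= u /\ forall y, y \in s -> t < y -> t' <= y.
Proof.
move=> tu; elim: s => [|x s [t' [tt' sP]]]; first by exists u; rewrite tu lexx.
have [xt|tx] := leP x t.
  exists t'; split=> // y; rewrite inE => /orP[/eqP->|]; last exact: sP.
  by rewrite ltNge xt.
exists (Num.min x t'); split; first by rewrite lt_min tx ge_min; lra.
move=> y; rewrite inE => /orP[/eqP->|ys ty]; first by rewrite ge_min lexx.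
by rewrite ge_min (sP y)// orbT.
Qed.

Lemma seq_left_gap (R : realType) (s : seq R) (t u : R) : u < t ->
  exists t', u <= t' < t /\ forall y, y \in s -> y < t -> y <= t'.
Proof.
move=> ut; elim: s => [|x s [t' [tt' sP]]]; first by exists u; rewrite ut lexx.
have [tx|xt] := leP t x.
  exists t'; split=> // y; rewrite inE => /orP[/eqP->|]; last exact: sP.
  by rewrite ltNge tx.
exists (Num.max x t'); split; first by rewrite gt_max xt le_max; lra.
move=> y; rewrite inE => /orP[/eqP->|ys ty]; first by rewrite le_max lexx.
by rewrite le_max (sP y)// orbT.
Qed.

Section Construction.
Variables (R : realType) (m : nat).
Local Notation M := m.+1.
Local Notation alpha := (angle R).
Local Notation turn := (@turn R).

(** The differences of marks are rational, which keeps their orbits under the irrational rotation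
    disjoint; [2 * M] steps of this size span only [1/3 < alpha], so the marks stay below 1. *)
Definition mark (k : nat) : R := 1 - alpha + k%:R / (6 * M%:R).

(* [brk 0] is the point where the rotation wraps around. The odd marks are kept
   free: [mark 1] provides an orbit that avoids all break points. *)
Definition brk (i : nat) : R := mark i.*2.

Lemma mark_range k : (k < M.*2)%N -> 1 - alpha <= mark k < 1.
Proof.
move=> kM; have a3 := angle_gt R; have M0 : 0 < M%:R :> R by [].
have h0 : 0 <= k%:R / (6 * M%:R) :> R by rewrite divr_ge0// mulr_ge0.
have h1 : k%:R / (6 * M%:R) < 3^-1 :> R.
  rewrite ltr_pdivrMr ?mulr_gt0//.
  have : k%:R < M.*2%:R :> R by rewrite ltr_nat.
  by rewrite -muln2 natrM; lra.
by rewrite /mark; move: (k%:R / _) h0 h1 => x; lra.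
Qed.

Lemma brk_range i : (i < M)%N -> 0 < brk i < 1.
Proof.
move=> iM; have a2 := angle_lt R.
have := @mark_range i.*2; rewrite ltn_double => /(_ iM); rewrite /brk; lra.
Qed.

Lemma brk0 : brk 0 = 1 - alpha.
Proof. by rewrite /brk /mark mul0r addr0. Qed.

Lemma brk_le i j : (i <= j)%N -> brk i <= brk j.
Proof.
by move=> ij; rewrite /brk /mark lerD2l ler_pM2r ?invr_gt0// ler_nat leq_double.
Qed.

Lemma brk_lt i j : (i < j)%N -> brk i < brk j.
Proof.
by move=> ij; rewrite /brk /mark ltrD2l ltr_pM2r ?invr_gt0// ltr_nat ltn_double.
Qed.

(** Multiplied by [6 * M], the equation makes [6 * M * s * alpha] an integer, so the time difference
    [s] is 0 by irrationality; then [k - j] is a multiple of [6 * M] smaller than [2 * M] in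
    absolute value. *)
Lemma mark_orbit_le n n' j k : (j < M.*2)%N -> (k < M.*2)%N -> (n' <= n)%N ->
  iter n turn (mark j) = iter n' turn (mark k) -> n = n' /\ j = k.
Proof.
move=> jM kM /subnK <-; set s := (n - n')%N.
have [p ->] := iter_turn_mod (s + n') (mark j).
have [q ->] := iter_turn_mod n' (mark k).
rewrite /mark natrD => E.
have M0 : 6 * M%:R != 0 :> R by rewrite mulf_neq0.
have {}E : (6 * M * s)%:R * alpha =
    ((6 * M)%:Z * (p%:Z - q%:Z) + (k%:Z - j%:Z))%:~R.
  rewrite !(intrD, intrM, intrN) -!pmulrn !natrM.
  have := divfK M0 j%:R; have := divfK M0 k%:R.
  move: (j%:R / _) (k%:R / _) E => x y E <- <-.
  have {}E : s%:R * alpha = p%:R - q%:R + y - x by lra.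
  by rewrite -!mulrA E -?mulrA; ring.
have [s0|s0] := posnP s; last first.
  by exfalso; move: E; rewrite -(@prednK (6 * M * s)) ?muln_gt0//; exact: angle_irrational.
split; first by rewrite s0.
move: E; rewrite s0 muln0 mul0r => /esym/eqP; rewrite intr_eq0 => /eqP E.
have [pq|pq] := eqVneq p q; first by move: E; rewrite pq; clear; lia.
move: E pq jM kM; clear; rewrite -muln2 => E pq jM kM; exfalso.
have [l|l] : (p < q)%N \/ (q < p)%N by lia.
  have : ((6 * M)%:Z * (q%:Z - p%:Z) >= (6 * M)%:Z * 1)%R by nia.
  by lia.
have : ((6 * M)%:Z * (p%:Z - q%:Z) >= (6 * M)%:Z * 1)%R by nia.
by lia.
Qed.

Lemma mark_orbit_inj n n' j k : (j < M.*2)%N -> (k < M.*2)%N ->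
  iter n turn (mark j) = iter n' turn (mark k) -> n = n' /\ j = k.
Proof.
move=> jM kM E; have [nn|/ltnW nn] := leqP n' n; first exact: mark_orbit_le E.
by have [] := mark_orbit_le kM jM nn (esym E).
Qed.

Lemma brk_orbit_inj n n' i j : (i < M)%N -> (j < M)%N ->
  iter n turn (brk i) = iter n' turn (brk j) -> n = n' /\ i = j.
Proof.
move=> iM jM /mark_orbit_inj; rewrite !ltn_double => /(_ iM jM) [-> E].
by split=> //; apply: double_inj.
Qed.

Lemma brk_orbit_neq n i j : (i < M)%N -> (j < M)%N ->
  iter n.+1 turn (brk i) <> brk j.
Proof. by move=> iM jM /(@brk_orbit_inj n.+1 0 i j iM jM) []. Qed.

Lemma iter_brk_range n i : (i < M)%N -> 0 <= iter n turn (brk i) < 1.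
Proof. by move=> /brk_range h; apply: iter_turn_range; lra. Qed.

(** * Total gap lengths before an angle *)

Definition hits (b : nat -> bool) : R := \sum_(i < M) (b i)%:R.

Lemma hits_ge0 b : 0 <= hits b.
Proof. exact: sumr_ge0. Qed.

Lemma hits_true : hits (fun=> true) = M%:R.
Proof. by rewrite /hits sumr_const card_ord. Qed.

Lemma hits_le (b b' : nat -> bool) : (forall i, (i < M)%N -> b i -> b' i) -> hits b <= hits b'.
Proof.
move=> bb'; apply: ler_sum => i _; rewrite ler_nat.
by have := bb' i (ltn_ord i); case: (b i) => //= ->.
Qed.

Lemma eq_hits (b b' : nat -> bool) : (forall i, (i < M)%N -> b i = b' i) -> hits b = hits b'.
Proof. by move=> bb'; apply: eq_bigr => i _; rewrite bb'. Qed.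

Lemma hits_lt (b b' : nat -> bool) : (forall i, (i < M)%N -> b i -> b' i) ->
  ~~ b 0%N -> b' 0%N -> hits b < hits b'.
Proof.
move=> bb' b0 b'0; rewrite /hits !big_ord_recl /= (negbTE b0) b'0 ltr_leD//.
apply: ler_sum => i _; rewrite ler_nat.
have := bb' (lift ord0 i) (ltn_ord _).
by rewrite /= /bump /=; case: (b _) => //= ->.
Qed.

Lemma hits_bounded (b : nat -> nat -> bool) :
  bounded_by M%:R (fun n => hits (b n)).
Proof.
by move=> n; rewrite ger0_norm ?hits_ge0// -hits_true; exact: hits_le.
Qed.

Definition phip (t : R) : R :=
  half_series (fun n => hits (fun i => iter n.+1 turn (brk i) <= t)).

Definition phim (t : R) : R :=
  half_series (fun n => hits (fun i => iter n.+1 turn (brk i) < t)).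

Local Notation tb := (@hits_bounded _).

Lemma phim_le_phip t : phim t <= phip t.
Proof.
apply: (le_half_series tb tb) => n; apply: hits_le => i _; exact: ltW.
Qed.

Lemma phip_le_phim s t : s < t -> phip s <= phim t.
Proof.
move=> st; apply: (le_half_series tb tb) => n; apply: hits_le => i _ h.
exact: le_lt_trans h st.
Qed.

Lemma phip_le s t : s <= t -> phip s <= phip t.
Proof.
move=> st; apply: (le_half_series tb tb) => n; apply: hits_le => i _ h.
exact: le_trans h st.
Qed.

Lemma phim_le s t : s <= t -> phim s <= phim t.
Proof.
move=> st; apply: (le_half_series tb tb) => n; apply: hits_le => i _ h.
exact: lt_le_trans h st.
Qed.

(** The orbit of [brk 0] is dense, so some gap opens strictly between [s] and [t]. *)
Lemma phip_lt_phim s t : 0 <= s -> s < t -> t <= 1 -> phip s < phim t.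
Proof.
move=> s0 st t1; have d01 := @brk_range 0 isT.
have [|n nP] := @turn_dense_pos R (brk 0) s t _ s0 st t1; first by lra.
apply: (lt_half_series (m := n) tb tb).
  by move=> k; apply: hits_le => i _ h; exact: le_lt_trans h st.
by apply: hits_lt => [i _ h||]; [exact: le_lt_trans h st|rewrite -ltNge|]; lra.
Qed.

Lemma phim_eq_phip t : (forall n i, (i < M)%N -> iter n.+1 turn (brk i) <> t) ->
  phim t = phip t.
Proof.
move=> h; congr half_series; apply/funext => n; apply: eq_hits => i iM.
by rewrite lt_neqAle; case: eqP => // /h; case.
Qed.

(** Gaps open only at later images of break points, and these are never break points; hence a single
    point lies over [brk i]. *)
Lemma phim_brk i : (i < M)%N -> phim (brk i) = phip (brk i).
Proof. by move=> iM; apply: phim_eq_phip => n j jM; exact: brk_orbit_neq. Qed.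

Lemma phim_lt_phip n :
  phim (iter n.+1 turn (brk 0)) < phip (iter n.+1 turn (brk 0)).
Proof.
apply: (lt_half_series (m := n) tb tb) => [k|].
  by apply: hits_le => i _; exact: ltW.
by apply: hits_lt => [i _||]; rewrite ?ltxx ?lexx//; exact: ltW.
Qed.

Lemma phim1 : phim 1 = 2 * M%:R.
Proof.
rewrite -half_series_cst; congr half_series; apply/funext => n.
rewrite -hits_true; apply: eq_hits => i iM.
by have /andP[_ ->] := iter_brk_range n.+1 iM.
Qed.

Lemma phip1 : phip 1 = 2 * M%:R.
Proof.
rewrite -half_series_cst; congr half_series; apply/funext => n.
rewrite -hits_true; apply: eq_hits => i iM.
by have /andP[_ /ltW ->] := iter_brk_range n.+1 iM.
Qed.

Lemma turn_brk0 : turn (brk 0) = 0.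
Proof. by rewrite brk0 /turn ltxx subrr. Qed.

(** By disjointness of the orbits only the first image of [brk 0] falls on 0, and its gap has length
    1. This is why X starts at 1. *)
Lemma phip0 : phip 0 = 1.
Proof.
have h n i : (i < M)%N -> (iter n.+1 turn (brk i) <= 0) = ((n == 0)%N && (i == 0)%N).
  move=> iM; have /andP[l _] := iter_brk_range n.+1 iM.
  rewrite le_eqVlt ltNge l orbF; apply/eqP/andP => [E|[/eqP-> /eqP->]].
    have E' : iter n.+1 turn (brk i) = iter 1 turn (brk 0) by rewrite E /= turn_brk0.
    by have [[->] ->] := brk_orbit_inj iM (isT : (0 < M)%N) E'.
  by rewrite /= turn_brk0.
rewrite /phip (half_series_recl tb).
have -> : half_series (fun n => hits (fun i => iter n.+2 turn (brk i) <= 0)) = 0.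
  rewrite -[RHS](mulr0 2) -half_series_cst; congr half_series; apply/funext => n.
  by rewrite /hits big1// => i _; rewrite h.
rewrite mulr0 addr0.
rewrite (_ : hits _ = hits (fun i => i == 0)%N).
  by rewrite /hits big_ord_recl big1 ?addr0.
by apply: eq_hits => i iM; exact: (h 0%N).
Qed.

Lemma half_tail_small (e : R) : 0 < e -> exists k, 2^-1 ^+ k * (4 * M%:R) < e.
Proof.
move=> e0; have h : `|2^-1 : R| < 1 by rewrite ger0_norm ?invr_ge0//; lra.
have [k _ kP] := cvgr0_norm_lt _ (cvg_geometric (4 * M%:R) h) _ e0.
exists k; have /= := kP k (leqnn k); by rewrite ger0_norm 1?[in ltLHS]mulrC.
Qed.

Let orbit_prefix k :=
  [seq iter n.+1 turn (brk i) | n <- iota 0 k, i <- iota 0 M].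

Let mem_orbit_prefix k n i : (n < k)%N -> (i < M)%N ->
  iter n.+1 turn (brk i) \in orbit_prefix k.
Proof. by move=> nk iM; apply/allpairsP; exists (n, i); rewrite !mem_iota. Qed.

(** Right continuity: [t'] stops before the next of the finitely many early orbit points, so only
    the tail of the series can change. [phim_left] is the mirror image. *)
Lemma phip_right t e : 0 <= t < 1 -> 0 < e ->
  exists t', t < t' <= 1 /\ phim t' <= phip t + e.
Proof.
move=> /andP[t0 t1] e0; have [k kP] := half_tail_small e0.
have [t' [tt' sP]] := seq_right_gap (orbit_prefix k) t1.
exists t'; split=> //; rewrite -lerBlDl; apply: le_trans (ler_norm _) _.
apply: le_trans (ltW kP); apply: half_series_tail; [exact: tb|exact: tb|].
move=> n nk; apply: eq_hits => i iM.
have := sP _ (mem_orbit_prefix nk iM); set y := iter _ _ _.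
by case: (leP y t) => [yt _|ty /(_ isT)]; case: ltP => //; lra.
Qed.

Lemma phim_left t e : 0 < t <= 1 -> 0 < e ->
  exists t', 0 <= t' < t /\ phim t - e <= phip t'.
Proof.
move=> /andP[t0 t1] e0; have [k kP] := half_tail_small e0.
have [t' [tt' sP]] := seq_left_gap (orbit_prefix k) t0.
exists t'; split=> //; rewrite lerBlDl -lerBlDr; apply: le_trans (ler_norm _) _.
apply: le_trans (ltW kP); apply: half_series_tail; [exact: tb|exact: tb|].
move=> n nk; apply: eq_hits => i iM.
have := sP _ (mem_orbit_prefix nk iM); set y := iter _ _ _.
by case: (ltP y t) => [yt /(_ isT)|ty _]; case: leP => //; lra.
Qed.

(** * Projection of points to angles *)

Definition lies_over (x t : R) := 0 <= t <= 1 /\ phim t <= x <= phip t.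

(** The angle is the supremum of those with [phim t <= x]; if either inequality failed there,
    one-sided continuity would move the supremum. *)
Lemma over_exists x : 0 <= x <= 2 * M%:R -> exists t, lies_over x t.
Proof.
move=> /andP[x0 x1].
pose E : set R := [set t | 0 <= t <= 1 /\ phim t <= x].
have E0 : E 0.
  split; first by rewrite lexx ler01.
  apply: le_trans x0; rewrite -[leRHS](mulr0 2) -[leRHS]half_series_cst.
  have b0 : bounded_by (0 : R) (fun=> 0) by move=> n; rewrite normr0.
  apply: (le_half_series tb b0) => n; rewrite /hits big1// => i _.
  by have /andP[l _] := iter_brk_range n.+1 (ltn_ord i); rewrite ltNge l.
have ub : ubound E 1 by move=> t [/andP[]].
have hs : has_sup E by split; [exists 0|exists 1].
pose s := sup E.
have s0 : 0 <= s by apply: ub_le_sup => //; exists 1.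
have s1 : s <= 1 by apply: ge_sup => //; exists 0.
exists s; split; first by rewrite s0.
apply/andP; split; rewrite leNgt; apply/negP => h.
  have sn0 : 0 < s.
    rewrite lt_neqAle s0 andbT; apply/eqP => s00.
    by case: E0 => _; rewrite {1}s00; lra.
  have [||t' [/andP[t'0 t's] tP]] := @phim_left s ((phim s - x) / 2).
  - by rewrite sn0.
  - by lra.
  have [t Et t't] : exists2 t, E t & t' < t.
    have d0 : 0 < s - t' by lra.
    have [t Et tt] := sup_adherent d0 hs.
    by exists t => //; move: tt; rewrite -/s; lra.
  by have := phip_le_phim t't; case: Et => _; lra.
have [s1'|s1'] := ltP s 1; last first.
  have := phip_le s1'; rewrite phip1; lra.
have [||t' [/andP[st t'1] tP]] := @phip_right s (x - phip s).
- by rewrite s0.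
- by lra.
suff /(ub_le_sup (ex_intro _ 1 ub)) : E t' by rewrite -/s; lra.
split; last by lra.
by lra.
Qed.

(** * Behaviour of the gap totals under the rotation *)

Definition offset : R :=
  half_series (fun n => hits (fun i => 1 - alpha <= iter n turn (brk i))).

(** [turn] preserves the order of two angles unless exactly one of them wraps around; the difference
    of the wrap indicators corrects this case. *)
Lemma le_turn (y t : R) : 0 <= y < 1 -> 0 <= t < 1 ->
  (turn y <= turn t)%R%:R =
  (y <= t)%R%:R + ((1 - alpha <= y)%R%:R - (1 - alpha <= t)%R%:R) :> R.
Proof.
move=> y01 t01; rewrite /turn; have := angle_gt R; have := angle_lt R => ? ?.
case: (ltP y (1 - alpha)) => ?; case: (ltP t (1 - alpha)) => ?;
  case: (leP y t) => ?; case: leP => ? /=; lra.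
Qed.

Lemma lt_turn (y t : R) : 0 <= y < 1 -> 0 <= t <= 1 ->
  (turn y < turn t)%R%:R =
  (y < t)%R%:R + ((1 - alpha <= y)%R%:R - (1 - alpha <= t)%R%:R) :> R.
Proof.
move=> y01 t01; rewrite /turn; have := angle_gt R; have := angle_lt R => ? ?.
case: (ltP y (1 - alpha)) => ?; case: (ltP t (1 - alpha)) => ?;
  case: (ltP y t) => ?; case: ltP => ? /=; lra.
Qed.

Lemma hitsD3 (b b1 b2 : nat -> bool) (c : bool) :
  (forall i, (i < M)%N -> (b i)%:R = (b1 i)%:R + ((b2 i)%:R - c%:R) :> R) ->
  hits b = hits b1 + (hits b2 - M%:R * c%:R).
Proof.
move=> h; rewrite /hits (eq_bigr (fun i : 'I_M =>
  (b1 i)%:R + ((b2 i)%:R - c%:R))); last by move=> i _; exact: h.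
rewrite big_split/= sumrB; congr (_ + (_ - _)).
by rewrite sumr_const card_ord mulr_natl.
Qed.

Lemma half_series_hits3 (b b1 b2 : nat -> nat -> bool) (c : bool) :
  (forall n i, (i < M)%N ->
    (b n i)%:R = (b1 n i)%:R + ((b2 n i)%:R - c%:R) :> R) ->
  half_series (fun n => hits (b n)) = half_series (fun n => hits (b1 n)) +
    (half_series (fun n => hits (b2 n)) - 2 * M%:R * c%:R).
Proof.
move=> h.
have bc : bounded_by (M%:R * c%:R : R) (fun=> M%:R * c%:R).
  by move=> n; rewrite ger0_norm.
have bNc : bounded_by (M%:R * c%:R : R) (fun=> - (M%:R * c%:R)).
  by move=> n; rewrite normrN ger0_norm.
have b2c : bounded_by (M%:R + M%:R * c%:R : R) (fun n => hits (b2 n) - M%:R * c%:R).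
  by move=> n; rewrite (le_trans (ler_normB _ _))// lerD ?hits_bounded ?ger0_norm.
rewrite -[2 * _ * _]mulrA -half_series_cst -(half_seriesN bc).
rewrite -(half_seriesD tb bNc) -(half_seriesD tb b2c).
by congr half_series; apply/funext => n; apply: hitsD3 => i iM; exact: h.
Qed.

(** [le_turn] is summed over the orbits. The comparisons before the turn start at index 0: their
    first term counts the break points up to [t], the rest is half of [phip t]. The wraps of the
    orbits add up to the constant [offset], the wrap of [t] to the last term. *)
Lemma phip_turn t : 0 <= t < 1 -> phip (turn t) =
  2^-1 * phip t + offset + hits (fun i => brk i <= t)
  - 2 * M%:R * (1 - alpha <= t)%R%:R.
Proof.
move=> t01; rewrite {1}/phip (@half_series_hits3 _
  (fun n i => iter n turn (brk i) <= t)
  (fun n i => 1 - alpha <= iter n turn (brk i)) (1 - alpha <= t)); last first.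
  by move=> n i iM; rewrite iterS; apply: le_turn => //; exact: iter_brk_range.
rewrite (half_series_recl tb) -/offset /=.
rewrite -[half_series _]/(phip t); ring.
Qed.

Lemma phim_turn t : 0 <= t <= 1 -> phim (turn t) =
  2^-1 * phim t + offset + hits (fun i => brk i < t)
  - 2 * M%:R * (1 - alpha <= t)%R%:R.
Proof.
move=> t01; rewrite {1}/phim (@half_series_hits3 _
  (fun n i => iter n turn (brk i) < t)
  (fun n i => 1 - alpha <= iter n turn (brk i)) (1 - alpha <= t)); last first.
  by move=> n i iM; rewrite iterS; apply: lt_turn => //; exact: iter_brk_range.
rewrite (half_series_recl tb) -/offset /=.
rewrite -[half_series _]/(phim t); ring.
Qed.
End Construction.

(** * The lifted map and its pieces *)

Lemma closure_distP (R : realType) (A : set R) (x : R) :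
  closure A x <-> forall e, 0 < e -> exists2 y, A y & `|y - x| < e.
Proof.
split=> [Ax e e0|h B /nbhs_ballP[e /= e0 xB]].
  have [y [Ay xy]] := Ax _ (nbhsx_ballx x e e0).
  by exists y => //; rewrite distrC.
have [y Ay yx] := h _ e0; exists y; split=> //; apply: xB.
by rewrite /ball /= distrC.
Qed.

Section Map.
Variables (R : realType) (m : nat).
Local Notation M := m.+1.
Local Notation alpha := (angle R).
Local Notation turn := (@turn R).
Local Notation brk := (@brk R m).
Local Notation phip := (@phip R m).
Local Notation phim := (@phim R m).
Local Notation lies_over := (@lies_over R m).
Local Notation W := (2 * M%:R : R).

Definition cut (i : nat) : R := phip (brk i).

(** The right-hand side of [phip_turn] with [x] for [phip t], and with comparisons of cuts with [x]
    for those of break points with [t]; the wrap becomes the passage of [cut 0]. *)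
Definition cmap (x : R) : R := 2^-1 * x + offset R m
  + hits R m (fun i => cut i <= x) - W * (cut 0 <= x)%R%:R.

Definition node (i : nat) : R :=
  if i is j.+1 then (if (j < M)%N then cut j else W) else 1.

(* The two outer intervals are widened by 1 so that the outer pieces contain the
   end points of X. *)
Definition piece (i : nat) : set R :=
  `]node i - (i == 0%N)%:R, node i.+1 + (i == M)%:R[%classic `&` `[1, W]%classic.

Lemma cut_le_over x t i : (i < M)%N -> lies_over x t -> brk i <= t -> cut i <= x.
Proof.
move=> iM [t01 /andP[xl _]]; rewrite le_eqVlt => /predU1P[E|it].
  by move: xl; rewrite -E phim_brk.
exact: le_trans (phip_le_phim m it) xl.
Qed.

Lemma cut_lt_over x t i : (i < M)%N -> lies_over x t -> brk i < t -> cut i < x.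
Proof.
move=> iM [t01 /andP[xl _]] it; apply: lt_le_trans xl.
by have h := brk_range R iM; apply: phip_lt_phim; lra.
Qed.

Lemma over_lt_cut x t i : (i < M)%N -> lies_over x t -> t < brk i -> x < cut i.
Proof.
move=> iM [t01 /andP[_ xu]] it; apply: le_lt_trans xu _.
rewrite /cut -phim_brk//.
by have h := brk_range R iM; apply: phip_lt_phim; lra.
Qed.

Lemma over_cut x i : (i < M)%N -> lies_over x (brk i) -> x = cut i.
Proof.
by move=> iM [_]; rewrite phim_brk// /cut => ?; apply/eqP; rewrite eq_le andbC.
Qed.

Lemma over_phip t : 0 <= t <= 1 -> lies_over (phip t) t.
Proof. by move=> t01; split=> //; rewrite lexx phim_le_phip. Qed.

Lemma over_phim t : 0 <= t <= 1 -> lies_over (phim t) t.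
Proof. by move=> t01; split=> //; rewrite lexx phim_le_phip. Qed.

Lemma cut_le_overE x t i : (i < M)%N -> lies_over x t -> (cut i <= x) = (brk i <= t).
Proof.
move=> iM xt; case: (leP (brk i) t) => [it|ti].
  exact: (cut_le_over iM xt it).
by apply/negbTE; rewrite -ltNge; exact: (over_lt_cut iM xt ti).
Qed.

Lemma cmap_phip x t : lies_over x t -> t < 1 ->
  cmap x = phip (turn t) - 2^-1 * (phip t - x).
Proof.
move=> xt t1; have [t01 _] := xt; rewrite phip_turn; last by lra.
rewrite /cmap (cut_le_overE _ xt)// brk0.
rewrite (@eq_hits R m _ (fun i => brk i <= t)); first by ring.
by move=> i iM; exact: cut_le_overE.
Qed.

(** At a break point the map takes the value from the right, on the far side of the gap of length 1
    that it creates; so the formula from the left excludes these angles. *)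
Lemma cmap_phim x t : lies_over x t -> (forall i, (i < M)%N -> brk i <> t) ->
  cmap x = phim (turn t) + 2^-1 * (x - phim t).
Proof.
move=> xt tD; have [t01 _] := xt; rewrite phim_turn//.
rewrite /cmap (cut_le_overE _ xt)// brk0.
rewrite (@eq_hits R m _ (fun i => brk i < t)); first by ring.
by move=> i iM; rewrite (cut_le_overE iM xt) le_eqVlt; case: eqP => // /(tD _ iM).
Qed.

(** The semiconjugacy with the rotation: the formula from the right gives the upper bound, the one
    from the left the lower bound. *)
Lemma over_cmap x t : lies_over x t -> lies_over (cmap x) (turn t).
Proof.
move=> xt; have [t01 /andP[xl xu]] := xt.
have r01 := turn_range t01; split; first by lra.
have [t1|t1] := ltP t 1; last first.
  have tE : t = 1 by lra.
  (* Only [x = W] lies over 1, and only the formula from the left is available there. *)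
  have -> : cmap x = phim (turn t).
    rewrite (cmap_phim xt) => [|i /(brk_range R)]; last by lra.
    by move: xl xu; rewrite tE phip1 phim1 => ? ?; lra.
  by rewrite lexx phim_le_phip.
rewrite {2}(cmap_phip xt t1) lerBlDr lerDl mulr_ge0 ?invr_ge0 ?subr_ge0// andbT.
case: (pselect (exists2 i, (i < M)%N & brk i = t)) => [[i iM it]|tD].
  have xE : x = cut i by apply: over_cut => //; rewrite it.
  by rewrite (cmap_phip xt t1) xE /cut it subrr mulr0 subr0 phim_le_phip.
rewrite (cmap_phim xt) => [|i iM it]; last by apply: tD; exists i.
by rewrite lerDl mulr_ge0 ?invr_ge0 ?subr_ge0.
Qed.

(** Points below 1 also lie over the angle 0, so the lower bound is delicate there: only [brk 0]
    turns to 0, and the single point over it goes to [phip 0 = 1]. *)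
Lemma cmap_range x t : lies_over x t -> 1 <= cmap x <= W.
Proof.
move=> xt; have [t01 _] := xt; have r01 := turn_range t01.
have [_ /andP[l u]] := over_cmap xt; apply/andP; split; last first.
  apply: le_trans u _; rewrite -(phip1 R m); apply: phip_le; lra.
have [r0|r0] := ltP 0 (turn t).
  by apply: le_trans l; rewrite -(phip0 R m); exact: phip_le_phim.
have tE : t = brk 0.
  rewrite brk0; move: r0; rewrite /turn; have := angle_gt R; have := angle_lt R.
  by case: ifPn => ?; lra.
have t1 : t < 1 by have := @brk_range R m 0 isT; rewrite tE; lra.
have xE : x = cut 0 by apply: over_cut => //; rewrite -tE.
by rewrite (cmap_phip xt t1) xE /cut tE turn_brk0 phip0 subrr mulr0 subr0.
Qed.

Lemma iter_over n x t : lies_over x t -> lies_over (iter n cmap x) (iter n turn t).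
Proof. by move=> xt; elim: n => //= n; exact: over_cmap. Qed.

Lemma range_over x : 1 <= x <= W -> exists t, lies_over x t.
Proof. by move=> xX; apply: over_exists; lra. Qed.

Lemma iter_cmap_range n x : 1 <= x <= W -> 1 <= iter n cmap x <= W.
Proof.
move=> xX; have [t xt] := range_over xX.
by case: n => // n; exact: cmap_range (iter_over n xt).
Qed.

Lemma phip_turn_cmap t : 0 <= t < 1 -> cmap (phip t) = phip (turn t).
Proof.
move=> t01; have /over_phip pt : 0 <= t <= 1 by lra.
by rewrite (cmap_phip pt) ?subrr ?mulr0 ?subr0//; lra.
Qed.

Lemma iter_cmap_phip n t : 0 <= t < 1 ->
  iter n cmap (phip t) = phip (iter n turn t).
Proof.
move=> t01; elim: n => //= n ->; rewrite phip_turn_cmap//.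
exact: iter_turn_range.
Qed.

(** The number of break points before [t], hence the index of the piece over an angle that is not a
    break point; [find] returns [M] beyond the last one. *)
Definition label (t : R) : nat := find (fun j => t <= brk j) (iota 0 M).

Lemma label_le t : (label t <= M)%N.
Proof. by rewrite -[leqRHS](size_iota 0 M) find_size. Qed.

Lemma lt_label t i : (i < M)%N -> (i < label t)%N = (brk i < t).
Proof.
move=> iM; case: ltnP => il.
  have := before_find 0%N il; rewrite nth_iota// add0n => /negbT.
  by rewrite -ltNge.
have h : has (fun j => t <= brk j) (iota 0 M).
  by rewrite has_find size_iota (leq_ltn_trans il).
have := nth_find 0%N h; rewrite nth_iota ?add0n; last exact: leq_ltn_trans il iM.
by move=> tl; apply/esym/negbTE; rewrite -leNgt (le_trans tl)// brk_le.
Qed.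

Lemma cut_lt i j : (i < j)%N -> (j < M)%N -> cut i < cut j.
Proof.
move=> ij jM; have iM := ltn_trans ij jM.
apply: (cut_lt_over iM (over_phip _)); last exact: brk_lt.
by have := brk_range R jM; lra.
Qed.

Lemma cut_range i : (i < M)%N -> 1 < cut i < W.
Proof.
move=> iM; have h := brk_range R iM; apply/andP; split.
  by rewrite -(phip0 R m) /cut -phim_brk//; apply: phip_lt_phim; lra.
by rewrite -(phim1 R m); apply: phip_lt_phim; lra.
Qed.

Lemma node_lt i : (i <= M)%N -> node i < node i.+1.
Proof.
case: i => [|i] iM /=; first by have := @cut_range 0 isT; lra.
rewrite iM; case: ifPn => [iM'|_]; first exact: cut_lt.
by have := cut_range iM; lra.
Qed.

Lemma node_le i j : (i <= j)%N -> (j <= M.+1)%N -> node i <= node j.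
Proof.
elim: j => [|j IH] ij jM; first by case: i ij.
move: ij; rewrite leq_eqVlt => /predU1P[->//|ij].
exact: le_trans (IH ij (ltnW jM)) (ltW (node_lt jM)).
Qed.

Lemma nodeM : node M.+1 = W.
Proof. by rewrite /node ltnn. Qed.

Lemma node_range i : (i <= M.+1)%N -> 1 <= node i <= W.
Proof.
move=> iM; have := node_le (leq0n i) iM; have := node_le iM (leqnn _).
by rewrite nodeM /= => -> ->.
Qed.

Lemma pieceP i x : (i <= M)%N -> piece i x <->
  [/\ 1 <= x <= W, (forall j, (j < i)%N -> cut j < x) &
      (forall j, (i <= j)%N -> (j < M)%N -> x < cut j)].
Proof.
move=> iM; rewrite /piece /= !in_itv/=; split.
  move=> [/andP[l u] xX]; split=> // j.
    case: i iM l u => // i iM l _ ji; rewrite subr0 /= iM in l.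
    apply: le_lt_trans l; move: ji; rewrite ltnS leq_eqVlt => /predU1P[->//|ji].
    exact/ltW/cut_lt.
  move=> ij jM; have iM' := leq_ltn_trans ij jM.
  rewrite (ltn_eqF iM') addr0 iM' in u.
  apply: lt_le_trans u _; move: ij; rewrite leq_eqVlt => /predU1P[->//|ij].
  exact/ltW/cut_lt.
move=> [xX l u]; split=> //; apply/andP; split.
  case: i iM l {u} => [|i] iM l /=; first by lra.
  by rewrite subr0 iM l.
have [iM'|iM'] := ltnP i M; first by rewrite (ltn_eqF iM') addr0 u.
have -> : i = M by apply/eqP; rewrite eqn_leq iM iM'.
by rewrite eqxx /=; lra.
Qed.

#[local] Arguments node : simpl never.

Lemma nodeS i : (i < M)%N -> node i.+1 = cut i.
Proof. by rewrite /node => ->. Qed.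

Lemma over_piece x t : 1 <= x <= W -> lies_over x t ->
  (forall i, (i < M)%N -> brk i <> t) -> piece (label t) x.
Proof.
move=> xX xt tD; apply/pieceP; first exact: label_le.
split=> // j.
  move=> jl; have jM := leq_trans jl (label_le t).
  by apply: cut_lt_over xt _ => //; rewrite -lt_label.
move=> lj jM; apply: over_lt_cut xt _ => //; rewrite lt_neqAle.
by rewrite eq_sym leNgt -lt_label// -leqNgt lj andbT; apply/eqP/tD.
Qed.

Lemma hits_ltn i : (i <= M)%N -> hits R m (fun j => (j < i)%N) = i%:R.
Proof.
move=> iM; rewrite /hits -natr_sum; congr (_%:R).
rewrite -[RHS]muln1 -[in RHS](card_ord i) -sum_nat_const.
rewrite (big_ord_widen M (fun=> 1%N))// [RHS]big_mkcond /=.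
by apply: eq_bigr => j _; case: ltnP.
Qed.

Lemma cmap_affine i x : (i <= M)%N -> (forall j, (j < i)%N -> cut j <= x) ->
  (forall j, (i <= j)%N -> (j < M)%N -> x < cut j) ->
  cmap x = 2^-1 * x + (offset R m + i%:R - W * (0 < i)%N%:R).
Proof.
move=> iM l u; have h j : (j < M)%N -> (cut j <= x) = (j < i)%N.
  by move=> jM; case: ltnP => ji; [rewrite l|apply/negbTE; rewrite -ltNge u].
by rewrite /cmap (eq_hits _ h) hits_ltn// h//; ring.
Qed.

Lemma cmap_piece i x : (i <= M)%N -> piece i x ->
  cmap x = 2^-1 * x + (offset R m + i%:R - W * (0 < i)%N%:R).
Proof.
move=> iM /(pieceP _ iM)[_ l u]; apply: cmap_affine => // j ji.
exact/ltW/l.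
Qed.

Lemma cmap_cut i : (i < M)%N ->
  cmap (cut i) = 2^-1 * cut i + (offset R m + i.+1%:R - W).
Proof.
move=> iM; rewrite (@cmap_affine i.+1) ?mulr1// => j.
  by rewrite ltnS leq_eqVlt => /predU1P[->//|ji]; exact/ltW/cut_lt.
exact: cut_lt.
Qed.

Lemma piece_subset i x : (i <= M)%N -> piece i x -> node i <= x <= node i.+1.
Proof.
move=> iM; rewrite /piece /= !in_itv /= => -[/andP[l u] /andP[x1 xW]].
apply/andP; split.
  by case: i iM l {u} => [//|i] _; rewrite subr0 => /ltW.
have [iM'|iM'] := ltnP i M; last by rewrite /node ltnNge iM' xW.
by move: u; rewrite (ltn_eqF iM') addr0 => /ltW.
Qed.

Lemma subset_piece i x : (i <= M)%N -> node i < x < node i.+1 -> piece i x.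
Proof.
move=> iM /andP[l u]; have /andP[n1 _] := node_range (leqW iM).
have /andP[_ nW] := @node_range i.+1 iM.
rewrite /piece /= !in_itv /=; split.
  by apply/andP; split; [apply: le_lt_trans l|apply: lt_le_trans u _];
    rewrite ?lerBlDr lerDl.
by apply/andP; split; lra.
Qed.

Lemma closure_piece i : (i <= M)%N ->
  closure (piece i) = `[node i, node i.+1]%classic.
Proof.
move=> iM; rewrite eqEsubset; split.
  apply: subset_trans (itv_closed (x := node i) (y := node i.+1)).
  apply: closureS => x xi; rewrite /= in_itv /=; exact: piece_subset.
move=> x; rewrite /= in_itv /= => /andP[l u]; apply/closure_distP => e e0.
have nn := node_lt iM.
have [xu|xu] := ltP x (node i.+1).
  pose y := x + Num.min e (node i.+1 - x) / 2.
  have h : 0 < Num.min e (node i.+1 - x) by rewrite lt_min; lra.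
  have h1 : Num.min e (node i.+1 - x) <= e by rewrite ge_min lexx.
  have h2 : Num.min e (node i.+1 - x) <= node i.+1 - x by rewrite ge_min lexx orbT.
  exists y; first by apply: subset_piece => //; rewrite /y; lra.
  by rewrite /y addrAC subrr add0r ger0_norm; lra.
have xE : x = node i.+1 by lra.
pose y := x - Num.min e (x - node i) / 2.
have h : 0 < Num.min e (x - node i) by rewrite lt_min; lra.
have h1 : Num.min e (x - node i) <= e by rewrite ge_min lexx.
have h2 : Num.min e (x - node i) <= x - node i by rewrite ge_min lexx orbT.
exists y; first by apply: subset_piece => //; rewrite /y; lra.
by rewrite /y addrAC subrr add0r normrN ger0_norm; lra.
Qed.

Lemma piece_lt i j x y : (i < j)%N -> (j <= M)%N -> piece i x -> piece j y -> x < y.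
Proof.
move=> ij jM; have iM : (i < M)%N := leq_trans ij jM.
move=> /(pieceP _ (ltnW iM))[_ _ u] /(pieceP _ jM)[_ l _].
exact: lt_trans (u i (leqnn i) iM) (l i ij).
Qed.

Lemma interval_partition_piece : interval_partition 1 W M.+1 piece.
Proof.
split.
- move=> i; rewrite ltnS => iM; split.
    exists ((node i + node i.+1) / 2); apply: subset_piece => //.
    by have := node_lt iM; lra.
  move=> x y; rewrite /piece /= !in_itv /= => -[/andP[? ?] /andP[? ?]].
  move=> [/andP[? ?] /andP[? ?]] z /andP[? ?].
  by split; rewrite /= in_itv /=; apply/andP; split; lra.
- move=> i _; eexists; split; last by reflexivity.
  exact: interval_open.
- move=> i j iM jM /eqP; rewrite neq_ltn => /orP[] ij; rewrite -subset0 => x [xi xj].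
    by have := piece_lt ij jM xi xj; rewrite ltxx.
  by have := piece_lt ij iM xj xi; rewrite ltxx.
- by move=> i j x y ij jM; exact: piece_lt.
- rewrite eqEsubset; split=> x.
    move=> [i /=]; rewrite ltnS => iM; rewrite closure_piece//= !in_itv /= => h.
    by have := node_range (leqW iM); have := @node_range i.+1 iM; lra.
  rewrite /= in_itv /= => xX.
  suff h k : (k <= M)%N -> x <= node k.+1 ->
      exists2 i, (i < M.+1)%N & closure (piece i) x.
    by apply: (h M) => //; rewrite nodeM; lra.
  elim: k => [|k IH] kM xk.
    have n0 : node 0 = 1 by [].
    by exists 0%N => //; rewrite closure_piece//= in_itv /= n0; lra.
  have [xk'|xk'] := leP x (node k.+1); first exact: IH (ltnW kM) xk'.
  by exists k.+1 => //; rewrite closure_piece//= in_itv /= (ltW xk') xk.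
Qed.

Lemma closure_piece_cut i : (i < M)%N ->
  closure (piece i) (cut i) /\ closure (piece i.+1) (cut i).
Proof.
move=> iM; rewrite !closure_piece ?(ltnW iM)//= !in_itv /= -nodeS// !lexx andbT.
by split; apply/ltW/node_lt => //; exact: ltnW.
Qed.

Lemma Delta_piece : Delta M.+1 piece = [set cut i | i in [set i | (i < M)%N]].
Proof.
rewrite eqEsubset; split=> x.
  move=> [i [j [iM jM /eqP]]]; wlog ij : i j iM jM / (i < j)%N.
    move=> h; rewrite neq_ltn => /orP[] ij xi xj; first by apply: (h i j); rewrite ?ltn_eqF.
    by apply: (h j i); rewrite ?ltn_eqF.
  move=> _; rewrite !closure_piece//= !in_itv /= => xi xj.
  have iM' : (i < M)%N := leq_trans ij jM.
  exists i => //=; have := node_le ij (leqW jM).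
  by move: xi xj; rewrite nodeS//; lra.
move=> [i /= iM <-]; have [ci ci'] := closure_piece_cut iM.
by exists i, i.+1; split=> //; exact: ltnW.
Qed.

Lemma cmap_discontinuous i : (i < M)%N ->
  ~ (cmap @ within `[1, W]%classic (nbhs (cut i)) --> cmap (cut i)).
Proof.
move=> iM /cvgrPdist_lt /(_ 2^-1); rewrite invr_gt0 => /(_ (ltr0Sn _ _)).
rewrite near_withinE => /nbhs_ballP[e /= e0 eP].
have nc : node i < cut i by have := node_lt (ltnW iM); rewrite nodeS.
(* The test point [cut i - d / 2] stays in piece [i]. The constants on the two sides differ by 1, or
   by [W - 1 >= 1] at [cut 0], and [d <= 1] limits the change from the slope to 1/4. *)
pose d := Num.min (Num.min e (cut i - node i)) 1.
have d0 : 0 < d by rewrite /d !lt_min e0 ltr01 andbT; lra.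
have d1 : d <= 1 by rewrite /d ge_min lexx orbT.
have de : d <= e by rewrite /d !ge_min lexx.
have dn : d <= cut i - node i by rewrite /d !ge_min lexx orbT.
have xi : piece i (cut i - d / 2).
  by apply: subset_piece; rewrite ?(ltnW iM)// nodeS//; lra.
have xX : 1 <= cut i - d / 2 <= W by have /(pieceP _ (ltnW iM))[] := xi.
have := eP (cut i - d / 2); rewrite /ball /= opprB addrC subrK ger0_norm; last by lra.
rewrite in_itv /= xX (cmap_piece (ltnW iM) xi) (cmap_cut iM).
have dl : d / 2 < e by lra.
move=> /(_ dl isT); rewrite -[i.+1%:R]natr1; have M1 : 1 <= M%:R :> R by rewrite ler1n.
move: M1; move: (M%:R : R) (cut i) (offset R m) => w c s M1.
clearbody d; case: i {iM nc dn xi xX eP} => [|i] /=; rewrite ltr_norml => /andP[]; lra.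
Qed.

Lemma piecewise_contracting_cmap : piecewise_contracting 1 W M.+1 piece cmap.
Proof.
split.
- exact: interval_partition_piece.
- move=> _ [x /= xX <-]; move: xX; rewrite !in_itv /= => xX.
  exact: (iter_cmap_range 1).
- by rewrite Delta_piece => _ [i /= iM <-]; exact: cmap_discontinuous.
- exists 2^-1; split; [lra|lra|] => i x y iM xi yi.
  rewrite !(cmap_piece iM)// opprD addrACA subrr addr0 -mulrBr normrM.
  by rewrite ger0_norm ?invr_ge0.
Qed.

Lemma piecewise_affine_cmap : piecewise_affine M.+1 piece cmap.
Proof.
by move=> i iM; do 2 eexists; move=> x; exact: cmap_piece.
Qed.

(** For [0 < i < j] the larger constant puts image [j] to the right of image [i]. The image of piece
    0 starts at [offset + 1/2], while all others end at or below [offset], since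
    [W / 2 + M - W = 0]. *)
Lemma separation_cmap : separation M.+1 piece cmap.
Proof.
exists (fun i x => 2^-1 * x + (offset R m + i%:R - W * (0 < i)%N%:R)); split.
- move=> i iM; split=> [|x xi]; last by rewrite (cmap_piece _ xi).
  apply: continuous_subspaceT => x.
  apply: cvgD; last exact: cvg_cst.
  by apply: cvgM; [exact: cvg_cst|exact: cvg_id].
- by move=> i iM x y _ _ /addIr /mulfI; apply; rewrite invr_neq0.
suff h i j x y : (i < j)%N -> (j <= M)%N -> closure (piece i) x -> closure (piece j) y ->
    2^-1 * x + (offset R m + i%:R - W * (0 < i)%N%:R) <>
    2^-1 * y + (offset R m + j%:R - W * (0 < j)%N%:R).
  move=> i j iM jM /eqP; rewrite neq_ltn => /orP[] ij; rewrite -subset0.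
    by move=> _ [[x xi <-] [y yj /esym]]; exact: h.
  by move=> _ [[x xi <-] [y yj]]; exact: h.
move=> ij jM; have iM : (i <= M)%N := ltnW (leq_trans ij jM).
rewrite !closure_piece//= !in_itv /= => xi yj.
have jr : j%:R <= M%:R :> R by rewrite ler_nat.
have ijr : i%:R < j%:R :> R by rewrite ltr_nat.
have xl := node_range (leqW iM); have yu := @node_range j.+1 jM.
have xy := node_le ij (leqW jM).
rewrite (leq_ltn_trans (leq0n i) ij).
by case: i ij iM xi ijr xl xy => [|i] ij iM xi ijr xl xy /=; lra.
Qed.

(** * Attractor and left-right visits *)

Local Notation attr := (attractor 1 W M.+1 piece cmap).
Local Notation atom := (atom 1 W piece cmap).

(** X without its open gaps. The value [phim 0] is excluded because it lies to the left of X;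
    [phip 1] coincides with [phim 1]. *)
Definition phi_values : set R := [set x |
  (exists2 t, 0 <= t < 1 & x = phip t) \/ (exists2 t, 0 < t <= 1 & x = phim t)].

Lemma phi_values_over x : phi_values x ->
  exists2 t, lies_over x t & x = phip t \/ x = phim t.
Proof.
move=> [[t t01 ->]|[t t01 ->]]; exists t; [|by left| |by right].
  by apply: over_phip; lra.
by apply: over_phim; lra.
Qed.

Lemma phi_values_range x : phi_values x -> 1 <= x <= W.
Proof.
move=> [[t /andP[t0 t1] ->]|[t /andP[t0 t1] ->]]; apply/andP; split.
- by rewrite -(phip0 R m); exact: phip_le.
- by rewrite -(phip1 R m); apply: phip_le; exact: ltW.
- by rewrite -(phip0 R m); exact: phip_le_phim.
- by rewrite -(phim1 R m); exact: phim_le.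
Qed.

Lemma over_gap_unique x s t : lies_over x s -> phim t < x < phip t -> s = t.
Proof.
move=> [_ /andP[l u]] /andP[tl tu]; apply/eqP; rewrite eq_le !leNgt.
apply/andP; split; apply/negP => /(@phip_le_phim R m) h; lra.
Qed.

Lemma phi_values_gap x t : phi_values x -> ~ (phim t < x < phip t).
Proof.
move=> /phi_values_over[s xs xE] h; move: xE.
by rewrite (over_gap_unique xs h); case=> E; move: h; rewrite E ltxx ?andbF.
Qed.

Lemma cmap_phi_values x : phi_values x -> phi_values (cmap x).
Proof.
have hp t : 0 <= t < 1 -> phi_values (cmap (phip t)).
  move=> t01; left; exists (turn t); last exact: phip_turn_cmap.
  by apply: turn_range; lra.
move=> [[t t01 ->]|[t t01 ->]]; first exact: hp.
case: (pselect (exists2 i, (i < M)%N & brk i = t)) => [[i iM <-]|tD].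
  by rewrite phim_brk//; apply: hp; have := brk_range R iM; lra.
have {}tD i : (i < M)%N -> brk i <> t by move=> iM it; apply: tD; exists i.
have t01' : 0 <= t <= 1 by lra.
right; exists (turn t); last first.
  by rewrite (cmap_phim (over_phim t01') tD) subrr mulr0 addr0.
have h : t <> 1 - alpha by have := @tD 0%N isT; rewrite brk0 => + E; apply.
have := turn_range t01'; have := angle_gt R; rewrite /turn.
case: (ltP t (1 - alpha)) => ? ? ?; first by lra.
have : 1 - alpha < t by rewrite lt_neqAle; apply/andP; split=> //; apply/eqP => E; apply: h.
by lra.
Qed.

Lemma iter_cmap_phi_values n x : phi_values x -> phi_values (iter n cmap x).
Proof. by move=> xL; elim: n => //= n; exact: cmap_phi_values. Qed.

(** A value [phip t] is approached from the right and [phim t] from the left: the projected orbit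
    enters a short interval beside [t], and one-sided continuity traps the point over it. That the
    point differs from [z] serves to show perfectness. *)
Lemma orbit_near x z e : 1 <= x <= W -> phi_values z -> 0 < e ->
  exists n, iter n cmap x != z /\ `|iter n cmap x - z| < e.
Proof.
move=> /range_over[s xs] zL e0; have [s01 _] := xs; have e2 : 0 < e / 2 by lra.
case: zL => [[t t01 ->]|[t t01 ->]].
  have [t' [tt' h]] := phip_right m t01 e2.
  have [n nP] : exists n, t < iter n turn s < t' by apply: turn_dense; lra.
  have [r01 /andP[l u]] := iter_over n xs.
  set r := iter n turn s in nP r01 l u; set y := iter n cmap x in l u *.
  have : phip t < phim r by apply: phip_lt_phim; lra.
  have : phip r <= phim t' by apply: phip_le_phim; lra.
  by exists n; rewrite -/y gt_eqF ?ltr_norml; lra.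
have [t' [tt' h]] := phim_left m t01 e2.
have [n nP] : exists n, t' < iter n turn s < t by apply: turn_dense; lra.
have [r01 /andP[l u]] := iter_over n xs.
set r := iter n turn s in nP r01 l u; set y := iter n cmap x in l u *.
have : phip r < phim t by apply: phip_lt_phim; lra.
have : phip t' <= phim r by apply: phip_le_phim; lra.
by exists n; rewrite -/y lt_eqF ?ltr_norml; lra.
Qed.

(** * Atoms avoid the open gaps *)

Lemma atom_rcons w i : atom (rcons w i) = closure (cmap @` (atom w `&` piece i)).
Proof. by rewrite /Defs.atom foldl_rcons. Qed.

Lemma atom_range w x : atom w x -> 1 <= x <= W.
Proof.
case/lastP: w => [|w i]; first by rewrite /Defs.atom /= in_itv.
rewrite atom_rcons.
have : cmap @` (atom w `&` piece i) `<=` `[1, W]%classic.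
  move=> _ [y [_ [_ yX]] <-]; move: yX; rewrite /= !in_itv /=.
  exact: (iter_cmap_range 1).
by move=> /closureS h /h /itv_closed; rewrite /= in_itv.
Qed.

(** A point inside an open gap has only one angle, so injectivity of [turn] applies; the angle 1 is
    ruled out because its point is sent to the end of a gap. *)
Lemma gap_pullback y t : 0 <= t < 1 -> 1 <= y <= W ->
  phim (turn t) < cmap y < phip (turn t) -> lies_over y t.
Proof.
move=> t01 yX yt; have [s ys] := range_over yX.
have := over_gap_unique (over_cmap ys) yt; have [s01 yl] := ys.
have [s1|s1] := ltP s 1; first by move/turn_inj => <- //; lra.
have sE : s = 1 by lra.
have E : cmap y = phim (turn s).
  rewrite (cmap_phim ys) => [|i /(brk_range R)]; last by lra.
  by move: yl; rewrite sE phip1 phim1 => ?; lra.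
by move=> st; move: yt; rewrite E st ltxx.
Qed.

Lemma atom_rcons_gap w i x l u : atom (rcons w i) x -> l < x < u ->
  exists y, [/\ atom w y, piece i y & l < cmap y < u].
Proof.
rewrite atom_rcons => /closure_distP xA xlu.
pose e := Num.min (x - l) (u - x).
have e0 : 0 < e by rewrite /e lt_min; lra.
have e1 : e <= x - l by rewrite /e ge_min lexx.
have e2 : e <= u - x by rewrite /e ge_min lexx orbT.
have [_ [y [yA yi] <-]] := xA _ e0; rewrite ltr_norml => yx.
by exists y; split=> //; lra.
Qed.

(** Pulled back along all [n.+1] letters, the point would end over [brk j], where only [cut j] lies;
    but no piece contains a cut. *)
Lemma atom_gap n w j x : size w = n.+1 -> all (fun i => (i < M.+1)%N) w ->
  (j < M)%N -> atom w x ->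
  ~ (phim (iter n.+1 turn (brk j)) < x < phip (iter n.+1 turn (brk j))).
Proof.
move=> + + jM; elim: n w x => [|n IH] w x; case/lastP: w => // w i;
  rewrite size_rcons => -[sw]; rewrite all_rcons => /andP[iM wM] xA;
  rewrite iterS => /(atom_rcons_gap xA)[y [yA yi yt]];
  have yX := atom_range yA; have yo := gap_pullback (iter_brk_range R _ jM) yX yt.
  have yE := over_cut jM yo; have [_ l u] := (pieceP _ iM).1 yi.
  have [ji|ij] := ltnP j i; first by have := l _ ji; rewrite yE ltxx.
  by have := u _ ij jM; rewrite yE ltxx.
apply: (IH w y sw wM yA).
set t := iter n.+1 turn (brk j) in yt yo *.
have t1 : t < 1 by have := iter_brk_range R n.+1 jM; rewrite -/t; lra.
have tD k : (k < M)%N -> brk k <> t by move=> kM /esym; exact: brk_orbit_neq.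
by have := cmap_phip yo t1; have := cmap_phim yo tD; lra.
Qed.

Lemma attractor_phi_values x : attr x -> phi_values x.
Proof.
move=> xA; have [|_ [w [[sw wM] -> _]] /atom_range xX] := xA 1%N; first by [].
have [t xt] := range_over xX; have [t01 /andP[l u]] := xt.
have [xp|xp] := eqVneq x (phip t).
  have [t1|t1] := ltP t 1; first by left; exists t => //; lra.
  have tE : t = 1 by lra.
  by right; exists 1; [rewrite ltr01 lexx|rewrite xp tE phip1 phim1].
have [xm|xm] := eqVneq x (phim t).
  have [t0|t0] := ltP 0 t; first by right; exists t => //; lra.
  have tE : t = 0 by lra.
  by exfalso; move: u xp; rewrite tE phip0 => u /eqP; apply; lra.
have gap : phim t < x < phip t by rewrite !lt_neqAle l u eq_sym xm xp.
(* A nonempty gap lies over some image [n.+1] of a break point, and the atoms of generation [n.+1]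
   already avoid it. *)
case: (pselect (exists n i, (i < M)%N /\ iter n.+1 turn (brk i) = t)).
  move=> [n [i [iM it]]].
  have [|A [v [[sv vM] -> _]] vx] := xA n.+1; first by [].
  by exfalso; apply: (atom_gap sv vM iM vx); rewrite it.
move=> tD; exfalso; move: gap; rewrite phim_eq_phip => [|n i iM it].
  by move=> /andP[h /(lt_trans h)]; rewrite ltxx.
by apply: tD; exists n, i.
Qed.

(** * Atoms along itineraries, and the attractor *)

Lemma atom_orbit w y : 1 <= y <= W ->
  (forall k, (k < size w)%N -> piece (nth 0%N w k) (iter k cmap y)) ->
  atom w (iter (size w) cmap y).
Proof.
move=> yX; elim/last_ind: w => [|w i IH] wP; first by rewrite /Defs.atom /= in_itv.
rewrite size_rcons atom_rcons; apply: subset_closure.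
exists (iter (size w) cmap y) => //; split.
  apply: IH => k kw; have := wP k; rewrite size_rcons nth_rcons kw.
  by apply; rewrite ltnS ltnW.
by have := wP (size w); rewrite size_rcons nth_rcons ltnn eqxx; apply.
Qed.

Definition itinerary n (t : R) : seq nat := mkseq (fun k => label (iter k turn t)) n.

Lemma word_itinerary n t : word M.+1 n (itinerary n t).
Proof.
split; first by rewrite size_mkseq.
by apply/allP => _ /mapP[k _ ->]; rewrite ltnS label_le.
Qed.

Lemma itinerary_atom n y t : 1 <= y <= W -> lies_over y t ->
  (forall k i, (k < n)%N -> (i < M)%N -> brk i <> iter k turn t) ->
  atom (itinerary n t) (iter n cmap y).
Proof.
move=> yX yt tD; rewrite -[in iter n](size_mkseq (fun k => label (iter k turn t)) n).
apply: atom_orbit => // k; rewrite size_mkseq => kn; rewrite nth_mkseq//.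
apply: over_piece; [exact: iter_cmap_range|exact: iter_over|].
by move=> i iM; exact: tD.
Qed.

(** No backward orbit of these angles meets a break point, so for every [n] the point is an [n]-th
    image along a well-defined itinerary. *)
Lemma mark1_attractor k : attr (phip (iter k turn (mark R m 1))).
Proof.
move=> n n1; have m01 : 0 <= mark R m 1 < 1.
  by have := angle_lt R; have := @mark_range R m 1 isT; lra.
have [s s01 sE] := iter_turn_surj n (iter_turn_range k m01).
have s01' : 0 <= s <= 1 by lra.
have pX : 1 <= phip s <= W.
  by apply: phi_values_range; left; exists s.
have pA : atom (itinerary n s) (phip (iter k turn (mark R m 1))).
  rewrite -sE -iter_cmap_phip//; apply: itinerary_atom => //.
    exact: over_phip.
  move=> j i jn iM E; have : iter k turn (mark R m 1) = iter (n - j) turn (brk i).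
    by rewrite -sE E -iterD subnK// ltnW.
  (* Parity: the index 1 is odd, those of the break points are even. *)
  by move=> /mark_orbit_inj[]//; rewrite ?ltn_double//; case: i {iM E}.
exists (atom (itinerary n s)) => //; exists (itinerary n s).
by split=> //; [exact: word_itinerary|exists (phip (iter k turn (mark R m 1)))].
Qed.

Lemma closed_atom w : closed (atom w).
Proof.
case/lastP: w => [|w i]; first exact: itv_closed.
by rewrite atom_rcons; exact: closed_closure.
Qed.

Lemma finite_atoms n : finite_set (atoms 1 W M.+1 piece cmap n).
Proof.
apply: (@sub_finite_set _ _ (range (fun w : n.-tuple 'I_M.+1 => atom (map val w)))).
  move=> _ [w [[sw wM] -> _]].
  pose v : seq 'I_M.+1 := map inord w.
  have sv : size v == n by rewrite size_map sw.
  exists (Tuple sv) => //=; congr Defs.atom; rewrite -map_comp map_id_in// => i iw /=.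
  by rewrite inordK//; exact: (allP wM).
exact/finite_image/finite_finset.
Qed.

Lemma closed_attractor : closed attr.
Proof.
apply: closed_bigI => n _; apply: closed_bigcup; first exact: finite_atoms.
by move=> _ [w [_ -> _]]; exact: closed_atom.
Qed.

(** The points over the orbit of [mark 1] belong to the closed attractor and come arbitrarily close
    to every element of [phi_values]. *)
Lemma attractorE : attr = phi_values.
Proof.
rewrite eqEsubset; split=> x; first exact: attractor_phi_values.
move=> xL; apply: closed_attractor; apply/closure_distP => e e0.
have m01 : 0 <= mark R m 1 < 1.
  by have := angle_lt R; have := @mark_range R m 1 isT; lra.
have pX : 1 <= phip (mark R m 1) <= W.
  by apply: phi_values_range; left; exists (mark R m 1).
have [n [_ nP]] := orbit_near pX xL e0.
by exists (iter n cmap (phip (mark R m 1))); rewrite ?iter_cmap_phip//;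
  [exact: mark1_attractor|rewrite -iter_cmap_phip].
Qed.

Lemma minimal_attractor : minimal_set cmap attr.
Proof.
rewrite attractorE; split=> [_ [x xL <-]|x xL z zL]; first exact: cmap_phi_values.
apply/closure_distP => e e0.
have [n [_ nP]] := orbit_near (phi_values_range xL) zL e0.
by exists (iter n cmap x) => //; exists n.
Qed.

(** Over distinct angles, density puts a gap at an image of [brk 0] between the points; over the
    same angle they are the two ends of a gap. The midpoint of the gap is the witness. *)
Lemma phi_values_between x y : phi_values x -> phi_values y -> x < y ->
  exists2 z, x < z < y & ~ phi_values z.
Proof.
move=> xL yL xy; have [s xs xE] := phi_values_over xL.
have [t yt yE] := phi_values_over yL.
have [s01 /andP[xl xu]] := xs; have [t01 /andP[yl yu]] := yt.
suff [r rP] : exists r, x <= phim r /\ phim r < phip r <= y.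
  exists ((phim r + phip r) / 2); first by lra.
  by move=> /(@phi_values_gap _ r); apply; lra.
have [st|ts|st] := ltgtP s t.
- have d01 := @brk_range R m 0 isT.
  have [n nP] : exists n, s < iter n.+1 turn (brk 0) < t.
    by apply: turn_dense_pos; lra.
  exists (iter n.+1 turn (brk 0)); have := phim_lt_phip R m n.
  set r := iter _ _ _ in nP *.
  have : phip s <= phim r by apply: phip_le_phim; lra.
  have : phip r <= phim t by apply: phip_le_phim; lra.
  by move=> *; split; lra.
- by have := phip_le_phim m ts; lra.
- exists s; rewrite -st in yl yu yE; have := phim_le_phip m s.
  by case: xE => E1; case: yE => E2; rewrite E1 E2 in xy *; split; lra.
Qed.

Lemma cantor_attractor : cantor_set attr.
Proof.
split.
- by rewrite attractorE; exists (phip 0); left; exists 0 => //; lra.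
- apply: (subclosed_compact closed_attractor (@segment_compact R 1 W)).
  by rewrite attractorE => x /phi_values_range; rewrite /= in_itv.
- split; first exact: closed_attractor.
  rewrite eqEsubset; split=> [x|x].
    by move=> /subset_limit_point; exact: closed_attractor.
  rewrite attractorE => xL U /nbhs_ballP[e /= e0 eU].
  have [n [nx nP]] := orbit_near (phi_values_range xL) xL e0.
  exists (iter n cmap x); split=> //; first exact: iter_cmap_phi_values.
  by apply: eU; rewrite /ball /= distrC.
- rewrite attractorE => x xL; rewrite eqEsubset; split; last first.
    by move=> _ ->; exact: connected_component_refl.
  move=> y [C [Cx CL /connected_intervalP Ci] Cy] /=.
  have [xy|xy|//] := ltgtP y x.
    have [z /andP[zy zx]] := phi_values_between (CL _ Cy) (CL _ Cx) xy.
    by case; apply: CL; apply: (Ci y x) => //; rewrite !ltW.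
  have [z /andP[zy zx]] := phi_values_between (CL _ Cx) (CL _ Cy) xy.
  by case; apply: CL; apply: (Ci x y) => //; rewrite !ltW.
Qed.

(** Within radius [e] no angle crosses the wrap point [brk 0] before time [n], so the iterates act
    as translations. Time [n] is included in the distances because the orbit of [t] may then sit on
    one break point and must stay away from the others. *)
Lemma turn_nbhd n (t : R) : 0 < t < 1 ->
  (forall k i, (k < n)%N -> (i < M)%N -> brk i <> iter k turn t) ->
  exists2 e, 0 < e /\ (0 <= t - e /\ t + e <= 1) &
    (forall k s, (k <= n)%N -> `|s - t| < e ->
      iter k turn s = iter k turn t + (s - t)) /\
    (forall k i, (k <= n)%N -> (i < M)%N -> brk i <> iter k turn t ->
      e <= `|iter k turn t - brk i|).
Proof.
move=> t01 tD.
pose d := [seq `|iter k turn t - brk i| | k <- iota 0 n.+1, i <- iota 0 M].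
have u0 : 0 < Num.min t (1 - t) by rewrite lt_min; lra.
(* Applied at 0, this yields a positive lower bound for all nonzero distances in [d]. *)
have [e [/andP[e0 eu] eP]] := seq_right_gap d u0.
move: eu; rewrite le_min => /andP[et e1t].
have ed k i : (k <= n)%N -> (i < M)%N -> brk i <> iter k turn t ->
    e <= `|iter k turn t - brk i|.
  move=> kn iM it; apply: eP.
    by apply/allpairsP; exists (k, i); rewrite !mem_iota.
  by rewrite normr_gt0 subr_eq0; apply/eqP => /esym.
exists e; first by split=> //; lra.
split=> //; elim=> [|k IH] s kn st; first by rewrite /=; lra.
rewrite !iterS (IH _ (ltnW kn) st).
have := ed k 0%N (ltnW kn) isT (tD k 0%N kn isT); rewrite brk0.
set r := iter k turn t; move: st; rewrite /turn ltr_norml leNgt ltr_norml => st er.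
case: ltP => ?; case: ltP => ?; lra.
Qed.

Lemma label_near (s t e : R) :
  (forall i, (i < M)%N -> e <= `|t - brk i|) -> `|s - t| < e -> label s = label t.
Proof.
move=> te; rewrite ltr_norml => st; apply: eq_in_find => i; rewrite mem_iota => /andP[_ iM].
by have := te i iM; rewrite leNgt ltr_norml; case: leP => ?; case: leP => ?; lra.
Qed.

(** No break point separates the orbits of [s] and [t] before time [n], so both follow one
    itinerary. *)
Lemma near_atom n (t e s y : R) :
  (forall k i, (k < n)%N -> (i < M)%N -> e <= `|iter k turn t - brk i|) ->
  (forall k s, (k <= n)%N -> `|s - t| < e -> iter k turn s = iter k turn t + (s - t)) ->
  `|s - t| < e -> 1 <= y <= W -> lies_over y s -> atom (itinerary n t) (iter n cmap y).
Proof.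
move=> te tn st yX ys.
have -> : itinerary n t = itinerary n s.
  apply/eq_in_map => k; rewrite mem_iota => /andP[_ kn]; apply/esym.
  apply: (@label_near _ _ e); first by move=> i; exact: te.
  by rewrite (tn _ _ (ltnW kn) st) addrAC subrr add0r.
apply: itinerary_atom => // k i kn iM E; have := te k i kn iM.
rewrite E (tn _ _ (ltnW kn) st) opprD addrA subrr add0r normrN leNgt st//.
Qed.

(** Let [t] be the [n]-th preimage of [brk i]. By density the projected orbit comes within [e] of
    [t] on either side; [n] steps later it is just left or right of [brk i], in the one atom given
    by the itinerary of [t]. *)
Lemma Delta_lr_cut x i : 1 <= x <= W -> (i < M)%N ->
  Delta_lr 1 W M.+1 piece cmap x (cut i).
Proof.
move=> xX iM n /= n1; have [ci ci'] := closure_piece_cut iM.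
exists i; split=> //.
have b01 := brk_range R iM; have [|t t01 tE] := @iter_turn_surj R n (brk i); first by lra.
have tD k j : (k < n)%N -> (j < M)%N -> brk j <> iter k turn t.
  move=> kn jM E; apply: (@brk_orbit_neq R m (n - k).-1 j i jM iM).
  by rewrite prednK ?subn_gt0// E -iterD subnK ?tE// ltnW.
(* As [turn (brk 0) = 0], the value [t = 0] would make [brk i] a later image of [brk 0]. *)
have t0 : 0 < t.
  rewrite lt_neqAle; apply/andP; split; last by lra.
  apply/eqP => E; apply: (@brk_orbit_neq R m n 0 i isT iM).
  by rewrite iterSr turn_brk0 E.
have t01' : 0 < t < 1 by lra.
have [e [e0 [te0 te1]] [tn td]] := turn_nbhd t01' tD.
have te k j : (k < n)%N -> (j < M)%N -> e <= `|iter k turn t - brk j|.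
  by move=> kn jM; apply: td => //; [exact: ltnW|exact: tD].
have [r xr] := range_over xX; have [r01 _] := xr.
have visit T : `|iter T turn r - t| < e ->
    atom (itinerary n t) (iter (T + n) cmap x) /\
    lies_over (iter (T + n) cmap x) (brk i + (iter T turn r - t)).
  move=> h; rewrite addnC iterD; split.
    by apply: near_atom te tn h _ _; [exact: iter_cmap_range|exact: iter_over].
  by rewrite -tE -(tn n _ (leqnn n) h) -!iterD; exact: iter_over.
(* No other break point lies within [e] of [brk i], so the two visits fall in pieces [i] and
   [i.+1]. *)
have sep j : (j < M)%N -> j <> i -> e <= `|brk i - brk j|.
  move=> jM ji; rewrite -tE; apply: td => //; rewrite tE => E; apply: ji.
  by have [] := @brk_orbit_inj R m 0 0 j i jM iM E.
have [T TP] : exists T, t - e < iter T turn r < t by apply: turn_dense; lra.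
have [T' TP'] : exists T, t < iter T turn r < t + e by apply: turn_dense; lra.
have [|TA To] := visit T; first by rewrite ltr_norml; lra.
have [|TA' To'] := visit T'; first by rewrite ltr_norml; lra.
exists (atom (itinerary n t)); split.
- split; last by exists T.
  exists (itinerary n t); split=> //; first exact: word_itinerary.
  by exists (iter (T + n) cmap x).
(* [cut i] is the [n]-th image of [phip t], over the centre [t] of the neighbourhood. *)
- rewrite /cut -tE -iter_cmap_phip; last by lra.
  apply: (near_atom te tn (s := t)); rewrite ?subrr ?normr0//.
    by apply: phi_values_range; left; exists t.
  by apply: over_phip; lra.
- exists T; split=> //; apply/pieceP; first exact: ltnW.
  split; first exact: iter_cmap_range.
    move=> j ji; have jM := ltn_trans ji iM; apply: (cut_lt_over jM To).
    have ji' : j <> i by move=> E; rewrite E ltnn in ji.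
    have bji := brk_lt R m ji; have := sep j jM ji'; rewrite ger0_norm; lra.
  move=> j ij jM; apply: (over_lt_cut jM To).
  by have := brk_le R m ij; lra.
- exists T'; split=> //; apply/pieceP => //.
  split; first exact: iter_cmap_range.
    move=> j; rewrite ltnS => ji; apply: (cut_lt_over (leq_ltn_trans ji iM) To').
    by have := brk_le R m ji; lra.
  move=> j ij jM; apply: (over_lt_cut jM To').
  have ji : j <> i by move=> E; rewrite E ltnn in ij.
  have bij := brk_lt R m ij; have := sep j jM ji; rewrite ler0_norm; lra.
Qed.

Lemma Delta_lr_cmap x : 1 <= x <= W ->
  Delta_lr 1 W M.+1 piece cmap x = Delta M.+1 piece.
Proof.
move=> xX; rewrite eqEsubset; split=> c.
  move=> /(_ 1%N isT) [i [iM ci ci' _]]; exists i, i.+1.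
  by split=> //; exact: ltnW.
by rewrite Delta_piece => -[i /= iM <-]; exact: Delta_lr_cut.
Qed.

End Map.

Theorem theorem3 (R : realType) (N : nat) : (2 <= N)%N ->
  exists (a b : R) (P : nat -> set R) (f : R -> R),
    [/\ piecewise_contracting a b N P f /\ piecewise_affine N P f,
        separation N P f,
        minimal_set f (attractor a b N P f),
        cantor_set (attractor a b N P f) &
        forall x, `[a, b]%classic x -> Delta_lr a b N P f x = Delta N P].
Proof.
case: N => [|[|m]] // _.
(* [N = m.+2] pieces are separated by [m.+1] cuts; X runs from [phip 0 = 1] to [phip 1], the total
   length of all gaps. *)
exists 1, (2 * m.+1%:R), (@piece R m), (@cmap R m); split.
- split; [exact: piecewise_contracting_cmap|exact: piecewise_affine_cmap].
- exact: separation_cmap.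
- exact: minimal_attractor.
- exact: cantor_attractor.
- by move=> x; rewrite /= in_itv /=; exact: Delta_lr_cmap.
Qed.
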